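(* Let $s>0$ and let $E\subseteq2^\omega$ be a (lightface) $\Sigma^1_1$ class that is not $\sigma$-finite for $\mathcal H^s$, i.e. $E$ is not a countable union of $\mathcal H^s$-measurable sets of finite $\mathcal H^s$-measure. Then there is a closed set $C\subseteq E$ with $\mathcal H^s(C)=\infty$.
   Context: Cantor space $2^\omega$ carries the metric $d(x,y)=2^{-\min\{n:x(n)\ne y(n)\}}$ for $x\ne y$ and $d(x,x)=0$; $\mathcal H^s$ denotes $s$-dimensional Hausdorff measure with respect to this metric. *)

(* Defs.v *)
From Stdlib Require Import Reals Lra List Arith Classical ClassicalEpsilon.
Import ListNotations.
Open Scope R_scope.

Definition Cantor := nat -> bool.
Definition Baire := nat -> nat.

Definition first_diff (x y : Cantor) (n : nat) : Prop :=
  x n <> y n /\ (forall m, (m < n)%nat -> x m = y m).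

Definition cdist (x y : Cantor) : R :=
  match excluded_middle_informative (exists n, first_diff x y n) with
  | left H => / 2 ^ (proj1_sig (constructive_indefinite_description _ H))
  | right _ => 0
  end.

Definition cantor_closed (C : Cantor -> Prop) : Prop :=
  forall x, ~ C x -> exists eps, 0 < eps /\ forall y, cdist x y < eps -> ~ C y.

(** * Extended nonnegative reals [0, +oo] (no -oo needed) *)
Inductive ER := Fin (r : R) | PInf.

Definition ERle (a b : ER) : Prop :=
  match a, b with
  | _, PInf => True
  | PInf, Fin _ => False
  | Fin x, Fin y => x <= y
  end.

Definition ERadd (a b : ER) : ER :=
  match a, b with
  | Fin x, Fin y => Fin (x + y)
  | _, _ => PInf
  end.

Definition is_ER_lub (S : ER -> Prop) (v : ER) : Prop :=
  (forall w, S w -> ERle w v) /\ (forall z, (forall w, S w -> ERle w z) -> ERle v z).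
Definition is_ER_glb (S : ER -> Prop) (v : ER) : Prop :=
  (forall w, S w -> ERle v w) /\ (forall z, (forall w, S w -> ERle z w) -> ERle z v).

(* supremum (exists and is unique for every nonempty S) *)
Definition ER_sup (S : ER -> Prop) : ER :=
  match excluded_middle_informative (exists v, is_ER_lub S v) with
  | left H => proj1_sig (constructive_indefinite_description _ H)
  | right _ => PInf
  end.
(* infimum (exists for every set of nonnegative values; inf of empty = +oo) *)
Definition ER_inf (S : ER -> Prop) : ER :=
  match excluded_middle_informative (exists v, is_ER_glb S v) with
  | left H => proj1_sig (constructive_indefinite_description _ H)
  | right _ => PInf
  end.

Definition ER_series (a : nat -> R) : ER :=
  ER_sup (fun v => exists n, v = Fin (sum_f_R0 a n)).

(* diameter: sup of distances; the empty set has diameter 0 *)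
Definition diam (U : Cantor -> Prop) : R :=
  match ER_sup (fun v => exists x y, U x /\ U y /\ v = Fin (cdist x y)) with
  | Fin r => r
  | PInf => 0
  end.

Definition rpow (r s : R) : R :=
  if Rle_dec r 0 then 0 else Rpower r s.

Definition HausS_delta (s delta : R) (A : Cantor -> Prop) : ER :=
  ER_inf (fun v => exists U : nat -> (Cantor -> Prop),
            (forall x, A x -> exists i, U i x) /\
            (forall i, diam (U i) <= delta) /\
            v = ER_series (fun i => rpow (diam (U i)) s)).

(* H^s(A) = lim_{delta -> 0} H^s_delta(A) = sup_{delta > 0} H^s_delta(A) *)
Definition HausS (s : R) (A : Cantor -> Prop) : ER :=
  ER_sup (fun v => exists delta, 0 < delta /\ v = HausS_delta s delta A).

Definition HausS_measurable (s : R) (A : Cantor -> Prop) : Prop :=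
  forall T : Cantor -> Prop,
    HausS s T = ERadd (HausS s (fun x => T x /\ A x)) (HausS s (fun x => T x /\ ~ A x)).

Definition HausS_sigma_finite (s : R) (E : Cantor -> Prop) : Prop :=
  exists A : nat -> (Cantor -> Prop),
    (forall i, HausS_measurable s (A i)) /\
    (forall i, HausS s (A i) <> PInf) /\
    (forall x, E x <-> exists i, A i x).

Inductive rcode : Type :=
| RZero : rcode
| RSucc : rcode
| RProj : nat -> rcode
| RComp : rcode -> list rcode -> rcode
| RRec : rcode -> rcode -> rcode
| RMu : rcode -> rcode.

Inductive reval : rcode -> list nat -> nat -> Prop :=
| ev_zero v : reval RZero v 0
| ev_succ x v : reval RSucc (x :: v) (S x)
| ev_proj i v : (i < length v)%nat -> reval (RProj i) v (nth i v 0%nat)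
| ev_comp f gs v ys y : revals gs v ys -> reval f ys y -> reval (RComp f gs) v y
| ev_rec0 g h v y : reval g v y -> reval (RRec g h) (0%nat :: v) y
| ev_recS g h n v r y :
    reval (RRec g h) (n :: v) r -> reval h (n :: r :: v) y -> reval (RRec g h) (S n :: v) y
| ev_mu f v n :
    reval f (n :: v) 0%nat ->
    (forall m, (m < n)%nat -> exists k, reval f (m :: v) (S k)) ->
    reval (RMu f) v n
with revals : list rcode -> list nat -> list nat -> Prop :=
| evs_nil v : revals nil v nil
| evs_cons g gs v y ys : reval g v y -> revals gs v ys -> revals (g :: gs) v (y :: ys).

Definition npair (a b : nat) : nat := (Nat.div ((a + b) * (a + b + 1)) 2 + b)%nat.
Fixpoint seqcode (l : list nat) : nat :=
  match l with
  | nil => 0%nat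
  | a :: l' => S (npair a (seqcode l'))
  end.

Definition bprefix (x : Cantor) (n : nat) : nat :=
  seqcode (map (fun k => if x k then 1%nat else 0%nat) (seq 0 n)).
Definition nprefix (y : Baire) (n : nat) : nat :=
  seqcode (map y (seq 0 n)).

(* a recursive (total computable) binary relation on nat, given by its
   characteristic function: c outputs 0 iff the relation holds *)
Definition total_rec2 (c : rcode) : Prop :=
  forall a b, exists v, reval c [a; b] v.

(* lightface Sigma^1_1 subsets of 2^omega: projections along omega^omega
   of lightface Pi^0_1 subsets of 2^omega x omega^omega (Kleene normal form):
   x in E <-> exists y, forall n, R(x|n, y|n) with R recursive *)
Definition Sigma11 (E : Cantor -> Prop) : Prop :=
  exists c : rcode, total_rec2 c /\
    forall x, E x <-> exists y : Baire, forall n, reval c [bprefix x n; nprefix y n] 0%nat.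

(* Main.v *)
(** A subset of Cantor space of diameter 2^-n > 0 lies in a cylinder of the
    same diameter, so H^s is the supremum over n of the net premeasures given by
    covers with cylinders of length at least n.  These premeasures are strongly
    subadditive (of two cylinders that meet, one contains the other), hence
    continuous along arbitrary increasing unions, and Choquet's argument makes
    every analytic set capacitable for them: it contains closed sets of nearly
    the same premeasure.  In particular an analytic set of finite measure is
    measurable.  If every x in E had a cylinder meeting E in a set of finite
    measure, E would therefore be sigma-finite, there being only countably many
    cylinders.  So some x in E has all its cylinders [x|n] meeting E in infinite
    measure; with closed K_n inside E and [x|n] of measure at least n, the set
    {x} together with all K_n is closed, since the K_n shrink to x. *)

Require Import Defs.
From Stdlib Require Import Reals.
From Stdlib Require Import Lra Lia List Arith Classical ClassicalEpsilon.
Import ListNotations.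
Open Scope R_scope.

(** * Prefixes and dependent choice along prefixes *)

Definition agree {T : Type} (n : nat) (x y : nat -> T) : Prop :=
  forall i, (i < n)%nat -> x i = y i.

Definition pre (x : Cantor) (n : nat) : list bool := map x (seq 0 n).

Lemma pre_length x n : length (pre x n) = n.
Proof. unfold pre. now rewrite length_map, length_seq. Qed.

Lemma map_seq_agree {T : Type} (x y : nat -> T) n :
  agree n x y <-> map x (seq 0 n) = map y (seq 0 n).
Proof.
  split.
  - intros H. apply map_ext_in. intros a Ha. apply in_seq in Ha. apply H. lia.
  - intros H i Hi.
    assert (E := f_equal (fun l => nth_error l i) H). simpl in E.
    rewrite !nth_error_map in E.
    rewrite (nth_error_nth' (seq 0 n) 0%nat) in E by (rewrite length_seq; lia).
    rewrite seq_nth in E by lia. simpl in E. congruence.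
Qed.

Lemma firstn_pre x m j : (j <= m)%nat -> firstn j (pre x m) = pre x j.
Proof.
  intros H. unfold pre. replace m with (j + (m - j))%nat by lia.
  rewrite seq_app, map_app. rewrite <- (pre_length x j) at 1. unfold pre.
  now rewrite firstn_app, firstn_all, Nat.sub_diag, app_nil_r.
Qed.

Lemma agree_sym {T : Type} n (x y : nat -> T) : agree n x y -> agree n y x.
Proof. intros H i Hi. symmetry. now apply H. Qed.

Lemma agree_trans {T : Type} n (x y z : nat -> T) :
  agree n x y -> agree n y z -> agree n x z.
Proof. intros H1 H2 i Hi. rewrite H1; auto. Qed.

Lemma agree_le {T : Type} m n (x y : nat -> T) :
  (m <= n)%nat -> agree n x y -> agree m x y.
Proof. intros H1 H i Hi. apply H. lia. Qed.

(** The first hypothesis makes [P k] a property of the first [k] values only. Successive choices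
    that never change earlier values therefore converge, and the limit inherits every [P k]. *)
Lemma dependent_extension {T : Type} (P : nat -> (nat -> T) -> Prop) :
  (forall k g g', agree k g g' -> P k g -> P k g') ->
  (exists g, P 0%nat g) ->
  (forall k g, P k g -> exists g', agree k g g' /\ P (S k) g') ->
  exists g, forall k, P k g.
Proof.
  intros Hext H0 Hstep.
  destruct (constructive_indefinite_description _ H0) as [g0 Hg0].
  assert (step : forall k (g : {g | P k g}),
             {g' : {g' | P (S k) g'} | agree k (proj1_sig g) (proj1_sig g')}).
  { intros k [g Hg].
    destruct (constructive_indefinite_description _ (Hstep k g Hg)) as [g' [Ha Hg']].
    exists (exist _ g' Hg'). exact Ha. }
  pose (G := fix G k : {g | P k g} :=
               match k with
               | O => exist _ g0 Hg0
               | S k' => proj1_sig (step k' (G k'))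
               end).
  assert (HG : forall k, agree k (proj1_sig (G k)) (proj1_sig (G (S k)))).
  { intros k. exact (proj2_sig (step k (G k))). }
  assert (HG' : forall d k, agree k (proj1_sig (G k)) (proj1_sig (G (d + k)%nat))).
  { induction d as [|d IH]; intros k.
    - intros i Hi. reflexivity.
    - eapply agree_trans; [apply IH|].
      eapply agree_le; [|apply (HG (d + k)%nat)]. lia. }
  (* The value at [i] is frozen from stage [S i] on, so this diagonal agrees with [G k] below
     [k]. *)
  exists (fun i => proj1_sig (G (S i)) i). intros k.
  apply Hext with (proj1_sig (G k)); [|exact (proj2_sig (G k))].
  intros i Hi. symmetry.
  replace k with ((k - S i) + S i)%nat by lia. apply HG'. lia.
Qed.

Lemma infinite_pigeonhole {T : Type} (L : list T) (P : T -> nat -> Prop) :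
  (forall N, exists m t, (N <= m)%nat /\ In t L /\ P t m) ->
  exists t, In t L /\ forall N, exists m, (N <= m)%nat /\ P t m.
Proof.
  induction L as [|a L IH]; intros H.
  - destruct (H 0%nat) as (m & t & _ & [] & _).
  - destruct (classic (forall N, exists m, (N <= m)%nat /\ P a m)) as [Ha|Ha].
    { exists a. split; [now left|exact Ha]. }
    apply not_all_ex_not in Ha. destruct Ha as [N0 HN0].
    destruct IH as [t [Ht HP]].
    + intros N. destruct (H (Nat.max N N0)) as (m & t & Hm & [<-|Ht] & HP).
      * exfalso. apply HN0. exists m. split; [lia|exact HP].
      * exists m, t. repeat split; auto. lia.
    + exists t. split; [now right|exact HP].
Qed.

(** Compactness in the form of König's lemma: a prefix shared by infinitely many [z k] extends by
    one value, since only finitely many values compete for the next place. *)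
Lemma cluster_point {T : Type} (L : nat -> list T) (z : nat -> nat -> T) :
  (forall i k, (i < k)%nat -> In (z k i) (L i)) ->
  exists x, forall n N, exists k, (N <= k)%nat /\ agree n x (z k).
Proof.
  intros HL.
  apply (dependent_extension
           (fun n x => forall N, exists k, (N <= k)%nat /\ agree n x (z k))).
  - intros k g g' Hg H N. destruct (H N) as [m [Hm Ha]].
    exists m. split; auto. eapply agree_trans; [apply agree_sym, Hg|exact Ha].
  - exists (z 0%nat). intros N. exists N. split; auto. intros i Hi. lia.
  - intros n x H.
    destruct (infinite_pigeonhole (L n) (fun t m => agree n x (z m) /\ z m n = t))
      as [t [_ Ht]].
    (* Going past [S n] guarantees that the value of [z m] at [n] lies in the finite list [L n]. *)
    { intros N. destruct (H (Nat.max N (S n))) as [m [Hm Ha]].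
      exists m, (z m n). repeat split; auto. lia. apply HL. lia. }
    exists (fun i => if Nat.eq_dec i n then t else x i). split.
    + intros i Hi. destruct (Nat.eq_dec i n); [lia|reflexivity].
    + intros N. destruct (Ht N) as [m [Hm [Ha Hn]]]. exists m. split; auto.
      intros i Hi. destruct (Nat.eq_dec i n) as [->|Hne]; [now symmetry|].
      apply Ha. lia.
Qed.

(** * Sums over sets of finite strings *)

Definition lsum (f : list bool -> R) (l : list (list bool)) : R :=
  fold_right (fun u r => f u + r) 0 l.

(** For nonnegative [f] this bounds the unordered sum over all strings, expressed through its finite
    partial sums. *)
Definition bnd (f : list bool -> R) (c : R) : Prop :=
  forall l, NoDup l -> lsum f l <= c.

Lemma lsum_app f l1 l2 : lsum f (l1 ++ l2) = lsum f l1 + lsum f l2.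
Proof. induction l1 as [|a l1 IH]; simpl; [lra|]. rewrite IH. lra. Qed.

Lemma lsum_nonneg f l : (forall u, 0 <= f u) -> 0 <= lsum f l.
Proof. intros H. induction l as [|a l IH]; simpl; [lra|]. specialize (H a). lra. Qed.

Lemma lsum_le f g l : (forall u, f u <= g u) -> lsum f l <= lsum g l.
Proof. intros H. induction l as [|a l IH]; simpl; [lra|]. specialize (H a). lra. Qed.

Lemma lsum_plus f g l : lsum (fun u => f u + g u) l = lsum f l + lsum g l.
Proof. induction l as [|a l IH]; simpl; [lra|]. rewrite IH. lra. Qed.

Lemma lsum_incl f l l' :
  (forall u, 0 <= f u) -> NoDup l ->
  (forall u, In u l -> f u <> 0 -> In u l') ->
  lsum f l <= lsum f l'.
Proof.
  intros Hf Hl. revert l'. induction Hl as [|a l Ha Hl IH]; intros l' H; simpl.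
  - now apply lsum_nonneg.
  - destruct (Req_dec (f a) 0) as [E|E].
    + rewrite E, Rplus_0_l. apply IH. intros u Hu. apply H. now right.
    + destruct (in_split a l' (H a (or_introl eq_refl) E)) as (l1 & l2 & ->).
      assert (lsum f l <= lsum f (l1 ++ l2)).
      { apply IH. intros u Hu Hne.
        assert (Hin := H u (or_intror Hu) Hne).
        apply in_app_iff in Hin. apply in_app_iff.
        destruct Hin as [?|[->|?]]; tauto. }
      rewrite lsum_app in *. simpl. lra.
Qed.

Lemma bnd_nonneg f c : bnd f c -> 0 <= c.
Proof. intros H. exact (H [] (NoDup_nil _)). Qed.

Lemma bnd_le f c c' : c <= c' -> bnd f c -> bnd f c'.
Proof. intros H Hb l Hl. specialize (Hb l Hl). lra. Qed.

Lemma bnd_mono f g c : (forall u, f u <= g u) -> bnd g c -> bnd f c.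
Proof.
  intros H Hb l Hl. specialize (Hb l Hl). pose proof (lsum_le f g l H). lra.
Qed.

(** Any list for [f2] is merged with [l1] without repetition, and the pointwise inequality is summed
    over the merged list. Both subadditivity arguments and the splitting of a cover rest on this. *)
Lemma bnd_split f1 f2 f3 f4 c3 c4 l1 :
  (forall u, 0 <= f1 u) -> (forall u, 0 <= f2 u) ->
  (forall u, f1 u + f2 u <= f3 u + f4 u) ->
  bnd f3 c3 -> bnd f4 c4 -> NoDup l1 ->
  bnd f2 (c3 + c4 - lsum f1 l1).
Proof.
  intros H1 H2 H B3 B4 N1 l2 N2.
  set (l := nodup (list_eq_dec Bool.bool_dec) (l1 ++ l2)).
  assert (Nl : NoDup l) by apply NoDup_nodup.
  assert (lsum f1 l1 <= lsum f1 l).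
  { apply lsum_incl; auto. intros u Hu _. apply nodup_In, in_app_iff. now left. }
  assert (lsum f2 l2 <= lsum f2 l).
  { apply lsum_incl; auto. intros u Hu _. apply nodup_In, in_app_iff. now right. }
  pose proof (lsum_le _ _ l H) as HH. rewrite !lsum_plus in HH.
  specialize (B3 l Nl). specialize (B4 l Nl). lra.
Qed.

(** The cylinder of [u] has diameter 2^-|u|; this is the s-th power of that diameter. *)
Definition weight (s : R) (u : list bool) : R := Rpower (/ 2 ^ length u) s.

Definition wind (s : R) (F : list bool -> Prop) (u : list bool) : R :=
  if excluded_middle_informative (F u) then weight s u else 0.

Lemma weight_pos s u : 0 < weight s u.
Proof. apply exp_pos. Qed.

Lemma wind_nonneg s F u : 0 <= wind s F u.
Proof.
  unfold wind. destruct excluded_middle_informative; [|lra].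
  apply Rlt_le, weight_pos.
Qed.

Lemma wind_mono s (F G : list bool -> Prop) u :
  (F u -> G u) -> wind s F u <= wind s G u.
Proof.
  intros H. unfold wind. pose proof (weight_pos s u).
  do 2 destruct excluded_middle_informative; try lra. tauto.
Qed.

Fixpoint level (n : nat) : list (list bool) :=
  match n with
  | O => [[]]
  | S n' => map (cons true) (level n') ++ map (cons false) (level n')
  end.

Lemma in_level u : In u (level (length u)).
Proof.
  induction u as [|b u IH]; simpl; [now left|].
  apply in_app_iff. destruct b; [left|right]; now apply in_map.
Qed.

(** * The net premeasures *)

Definition covers (F : list bool -> Prop) (A : Cantor -> Prop) : Prop :=
  forall x, A x -> exists m, F (pre x m).

Definition net_cover (s : R) (n : nat) (A : Cantor -> Prop) (c : R) : Prop :=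
  exists F, (forall u, F u -> (n <= length u)%nat) /\ covers F A /\ bnd (wind s F) c.

Lemma net_cover_le s n A c c' : c <= c' -> net_cover s n A c -> net_cover s n A c'.
Proof.
  intros H (F & H1 & H2 & H3). exists F. repeat split; auto.
  now apply bnd_le with c.
Qed.

(** The finitely many strings of length [n] cover everything, so the premeasure at each level is a
    real number. *)
Lemma net_cover_exists s n A : exists c, net_cover s n A c.
Proof.
  exists (lsum (wind s (fun u => length u = n)) (level n)), (fun u => length u = n).
  repeat split.
  - intros u ->. lia.
  - intros x _. exists n. apply pre_length.
  - intros l Hl. apply lsum_incl; auto using wind_nonneg.
    intros u _. unfold wind. destruct excluded_middle_informative as [<-|]; [|lra].
    intros _. apply in_level.
Qed.

Lemma net_exists s n A :
  exists r, (forall c, net_cover s n A c -> r <= c) /\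
            (forall c, r < c -> net_cover s n A c).
Proof.
  (* The infimum of the costs is minus the supremum of their negatives. *)
  destruct (completeness (fun c => net_cover s n A (- c))) as [r [Hub Hlub]].
  - exists 0. intros c (F & _ & _ & H). apply bnd_nonneg in H. lra.
  - destruct (net_cover_exists s n A) as [c Hc]. exists (- c).
    now rewrite Ropp_involutive.
  - exists (- r). split.
    + intros c Hc. assert (- c <= r); [|lra].
      apply Hub. now rewrite Ropp_involutive.
    + intros c Hc. apply NNPP. intros Hn.
      assert (r <= - c); [|lra].
      apply Hlub. intros d Hd. apply Rnot_lt_le. intros Hlt. apply Hn.
      apply net_cover_le with (- d); auto. lra.
Qed.

Definition net (s : R) (n : nat) (A : Cantor -> Prop) : R :=
  proj1_sig (constructive_indefinite_description _ (net_exists s n A)).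

Lemma net_le_cover s n A c : net_cover s n A c -> net s n A <= c.
Proof.
  unfold net. destruct constructive_indefinite_description as [r [H1 H2]]. apply H1.
Qed.

Lemma net_cover_gt s n A c : net s n A < c -> net_cover s n A c.
Proof.
  unfold net. destruct constructive_indefinite_description as [r [H1 H2]]. apply H2.
Qed.

Lemma net_nonneg s n A : 0 <= net s n A.
Proof.
  apply Rnot_lt_le. intros H.
  destruct (net_cover_gt s n A (net s n A / 2) ltac:(lra)) as (F & _ & _ & HF).
  apply bnd_nonneg in HF. lra.
Qed.

Lemma net_mono s n m (A B : Cantor -> Prop) :
  (n <= m)%nat -> (forall x, A x -> B x) -> net s n A <= net s m B.
Proof.
  intros Hnm H. apply le_epsilon. intros e He.
  apply net_le_cover.
  destruct (net_cover_gt s m B (net s m B + e) ltac:(lra)) as (F & H1 & H2 & H3).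
  exists F. repeat split; auto.
  - intros u Hu. specialize (H1 u Hu). lia.
  - intros x Hx. auto.
Qed.

Lemma net_subadd s n (A B T : Cantor -> Prop) :
  (forall x, T x -> A x \/ B x) -> net s n T <= net s n A + net s n B.
Proof.
  intros HT. apply le_epsilon. intros e He.
  destruct (net_cover_gt s n A (net s n A + e / 2) ltac:(lra)) as (F & F1 & F2 & F3).
  destruct (net_cover_gt s n B (net s n B + e / 2) ltac:(lra)) as (G & G1 & G2 & G3).
  apply net_le_cover. exists (fun u => F u \/ G u). repeat split.
  - intros u [Hu|Hu]; auto.
  - intros x Hx. destruct (HT x Hx) as [Ha|Hb].
    + destruct (F2 x Ha) as [m Hm]. eauto.
    + destruct (G2 x Hb) as [m Hm]. eauto.
  - assert (Hb := bnd_split (fun _ => 0) (wind s (fun u => F u \/ G u))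
                    (wind s F) (wind s G) _ _ []
                    ltac:(intros; lra) (wind_nonneg s _)
                    ltac:(intros u; unfold wind; pose proof (weight_pos s u);
                          repeat destruct excluded_middle_informative; lra || tauto)
                    F3 G3 (NoDup_nil _)).
    simpl in Hb. eapply bnd_le; [|exact Hb]. lra.
Qed.

(** * Continuity along increasing unions *)

(** Keeping only the minimal strings preserves the union of the cylinders and makes the cylinders
    disjoint. *)
Definition outermost (F : list bool -> Prop) (u : list bool) : Prop :=
  F u /\ forall j, (j < length u)%nat -> ~ F (firstn j u).

Lemma outermost_prefix F x m : F (pre x m) -> exists j, outermost F (pre x j).
Proof.
  intros H.
  destruct (dec_inh_nat_subset_has_unique_least_element (fun m => F (pre x m)))
    as [j [[Hj Hmin] _]].
  - intros j. apply classic.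
  - eauto.
  - exists j. split; auto. intros i Hi Hb. rewrite pre_length in Hi.
    rewrite firstn_pre in Hb by lia. specialize (Hmin i Hb). lia.
Qed.

Definition below (U : nat -> list bool -> Prop) (K : nat) (u : list bool) : Prop :=
  exists k, (k <= K)%nat /\ U k u.

(* The families of outermost cylinders satisfy strong subadditivity: the
   cylinders of stage [K] together with those of [U (S K)] split into those of
   stage [S K] and a family covering the intersection of the two
   unions, which still contains [A K]. *)
Lemma outermost_bound s n U (A : nat -> Cantor -> Prop) (e : nat -> R) :
  (forall k x, A k x -> A (S k) x) ->
  (forall k u, U k u -> (n <= length u)%nat) ->
  (forall k, covers (U k) (A k)) ->
  (forall k, bnd (wind s (U k)) (net s n (A k) + e k)) ->
  forall K, bnd (wind s (outermost (below U K))) (net s n (A K) + sum_f_R0 e K).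
Proof.
  intros HA Hlen Hcov Hb. induction K as [|K IH].
  - apply bnd_mono with (wind s (U 0%nat)); [|simpl; auto].
    intros u. apply wind_mono. intros [(k & Hk & Hu) _].
    now replace 0%nat with k by lia.
  - set (V := outermost (below U K)) in *. set (W := U (S K)).
    set (M := fun u => (V u /\ exists j, W (firstn j u)) \/
                       (W u /\ exists j, V (firstn j u))).
    intros l Hl.
    (* [M] still covers [A K], and its weight is what [V] and [W] have beyond the new outermost
       strings. The two occurrences of [net s n (A K)] cancel, which leaves the bound for stage
       [S K]. *)
    assert (HM : net s n (A K) <= net s n (A K) + sum_f_R0 e K + (net s n (A (S K)) + e (S K))
                   - lsum (wind s (outermost (below U (S K)))) l).
    { apply net_le_cover. exists M. repeat split.
      - intros u [[Hu _]|[Hu _]].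
        + destruct Hu as [(k & _ & Hu) _]. now apply Hlen with k.
        + now apply Hlen with (S K).
      - intros x Hx.
        destruct (Hcov K x Hx) as [m0 Hm0].
        destruct (outermost_prefix (below U K) x m0) as [i Hi]; [now exists K|].
        destruct (Hcov (S K) x (HA K x Hx)) as [j Hj].
        (* Of the two prefixes of [x], one from each family, the longer one belongs to [M]. *)
        destruct (le_lt_dec i j) as [Hij|Hij].
        + exists j. right. split; auto. exists i. now rewrite firstn_pre.
        + exists i. left. split; auto. exists j. now rewrite firstn_pre by lia.
      - apply bnd_split with (wind s V) (wind s W); auto using wind_nonneg; [|apply Hb].
        assert (Hmax : forall u, outermost (below U (S K)) u -> V u \/ W u).
        { intros u [(k & Hk & Hu) Hout].
          destruct (Nat.eq_dec k (S K)) as [->|Hne]; [now right|left].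
          split; [exists k; split; auto; lia|].
          intros j Hj (k' & Hk' & Hu'). apply (Hout j Hj). exists k'. auto. }
        (* A string counted twice on the left must be counted twice on the right: its prefix from
           the other family cannot be proper, because the string is outermost. *)
        assert (Hboth : forall u, outermost (below U (S K)) u -> M u -> V u /\ W u).
        { assert (Hfull : forall u j, outermost (below U (S K)) u ->
                    (exists k, (k <= S K)%nat /\ U k (firstn j u)) -> firstn j u = u).
          { intros u j [_ Hout] Hk. apply firstn_all2.
            destruct (le_lt_dec (length u) j) as [|Hlt]; auto.
            destruct (Hout j Hlt Hk). }
          intros u Hu [[HV [j Hj]]|[HW [j Hj]]].
          - split; auto. rewrite <- (Hfull u j Hu); auto. exists (S K). auto.
          - split; auto. rewrite <- (Hfull u j Hu); auto.
            destruct Hj as [(k & Hk & HU) _]. exists k. auto. }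
        assert (HMor : forall u, M u -> V u \/ W u) by (unfold M; tauto).
        intros u. specialize (Hmax u). specialize (Hboth u). specialize (HMor u).
        unfold wind. pose proof (weight_pos s u).
        repeat destruct excluded_middle_informative; lra || tauto. }
    simpl. lra.
Qed.

Lemma sum_half_powers e K : 0 <= e -> sum_f_R0 (fun k => e * / 2 ^ S k) K <= e.
Proof.
  intros He. enough (sum_f_R0 (fun k => e * / 2 ^ S k) K = e - e * / 2 ^ S K) as ->.
  { assert (0 < / 2 ^ S K) by (apply Rinv_0_lt_compat, pow_lt; lra). nra. }
  induction K as [|K IH]; [simpl; field|].
  rewrite tech5, IH. simpl. field. apply pow_nonzero. lra.
Qed.

(** Cover [A k] with error [e / 2^(k+1)] and keep the outermost strings of all these covers
    together. Every finite part of them already appears at a finite stage, where [outermost_bound]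
    gives at most [L + e]. *)
Lemma net_increasing s n (A : nat -> Cantor -> Prop) (T : Cantor -> Prop) L :
  (forall k x, A k x -> A (S k) x) ->
  (forall x, T x -> exists k, A k x) ->
  (forall k, net s n (A k) <= L) ->
  net s n T <= L.
Proof.
  intros HA HT HL. apply le_epsilon. intros e He.
  assert (HU : forall k, net_cover s n (A k) (net s n (A k) + e * / 2 ^ S k)).
  { intros k. apply net_cover_gt.
    assert (0 < / 2 ^ S k) by (apply Rinv_0_lt_compat, pow_lt; lra). nra. }
  set (U := fun k => proj1_sig (constructive_indefinite_description _ (HU k))).
  assert (HU' : forall k, (forall u, U k u -> (n <= length u)%nat) /\
             covers (U k) (A k) /\ bnd (wind s (U k)) (net s n (A k) + e * / 2 ^ S k)).
  { intros k. exact (proj2_sig (constructive_indefinite_description _ (HU k))). }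
  clearbody U.
  pose proof (outermost_bound s n U A (fun k => e * / 2 ^ S k) HA
                (fun k => proj1 (HU' k)) (fun k => proj1 (proj2 (HU' k)))
                (fun k => proj2 (proj2 (HU' k)))) as HB.
  set (Any := fun u => exists k, U k u).
  set (V := outermost Any).
  apply net_le_cover. exists V. repeat split.
  - intros u [[k Hk] _]. now apply (HU' k).
  - intros x Hx. destruct (HT x Hx) as [k Hk].
    destruct (proj1 (proj2 (HU' k)) x Hk) as [m Hm].
    apply outermost_prefix with m. now exists k.
  - intros l Hl.
    (* a finite part of V already consists of outermost cylinders at a finite stage *)
    assert (HK : exists K, forall u, In u l -> V u -> outermost (below U K) u).
    { clear Hl. induction l as [|a l [K IH]]; [exists 0%nat; easy|].
      assert (Hout : forall u K', V u -> below U K' u -> outermost (below U K') u).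
      { intros u K' [_ Hu] Hb. split; auto.
        intros j Hj (k & _ & Hk). apply (Hu j Hj). now exists k. }
      destruct (classic (V a)) as [Ha|Ha].
      - destruct (proj1 Ha) as [k Hk]. exists (Nat.max K k).
        intros u [<-|Hu] Hv.
        + apply Hout; auto. exists k. split; auto; lia.
        + apply Hout; auto. destruct (IH u Hu Hv) as [(k' & Hk' & Hu') _].
          exists k'. split; auto. lia.
      - exists K. intros u [<-|Hu] Hv; [easy|auto]. }
    destruct HK as [K HK].
    assert (lsum (wind s V) l <= lsum (wind s (outermost (below U K))) l).
    { revert HK. clear. induction l as [|a l IH]; simpl; intros H; [lra|].
      assert (wind s V a <= wind s (outermost (below U K)) a) by (apply wind_mono; auto).
      assert (lsum (wind s V) l <= lsum (wind s (outermost (below U K))) l) by auto. lra. }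
    specialize (HB K l Hl). specialize (HL K).
    pose proof (sum_half_powers e K ltac:(lra)). lra.
Qed.

(** * Capacitability *)

Definition prefix_closed (C : Cantor -> Prop) : Prop :=
  forall x, (forall n, exists x', agree n x x' /\ C x') -> C x.

Definition prefix_closed2 (F : Cantor -> Baire -> Prop) : Prop :=
  forall x y,
    (forall n, exists x' y', agree n x x' /\ agree n y y' /\ F x' y') -> F x y.

(** Boldface analytic sets: projections of closed subsets of the product of Cantor and Baire
    space. *)
Definition analytic (A : Cantor -> Prop) : Prop :=
  exists F, prefix_closed2 F /\ forall x, A x <-> exists y, F x y.

(** The pairs of coordinates range over finite sets, so [cluster_point] applies. Asking for the
    bound only below [k] admits points whose witnesses are controlled on an initial segment
    alone. *)
Lemma bounded_cluster F (g : Baire) (xs : nat -> Cantor) (ys : nat -> Baire) :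
  prefix_closed2 F ->
  (forall k, F (xs k) (ys k)) ->
  (forall k i, (i < k)%nat -> (ys k i <= g i)%nat) ->
  exists x y, F x y /\ (forall i, (y i <= g i)%nat) /\
    forall n N, exists k, (N <= k)%nat /\ agree n x (xs k).
Proof.
  intros HF Hxy Hg.
  destruct (cluster_point (fun i => list_prod [true; false] (seq 0 (S (g i))))
              (fun k i => (xs k i, ys k i))) as [z Hz].
  { intros i k Hik. apply in_prod.
    - destruct (xs k i); simpl; auto.
    - apply in_seq. specialize (Hg k i Hik). lia. }
  assert (Hx : forall n k, agree n z (fun i => (xs k i, ys k i)) ->
                 agree n (fun i => fst (z i)) (xs k) /\
                 agree n (fun i => snd (z i)) (ys k)).
  { intros n k H. split; intros i Hi; now rewrite (H i Hi). }
  exists (fun i => fst (z i)), (fun i => snd (z i)). repeat split.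
  - apply HF. intros n. destruct (Hz n 0%nat) as [k [_ Hk]].
    apply Hx in Hk. exists (xs k), (ys k). now repeat split.
  - intros i. destruct (Hz (S i) (S i)) as [k [Hik Hk]].
    rewrite (Hk i) by lia. apply Hg. lia.
  - intros n N. destruct (Hz n N) as [k [Hik Hk]]. exists k. split; auto.
    now apply Hx.
Qed.

(** Choquet's argument: the bounds [g 0], [g 1], ... on the witness are fixed one at a time, keeping
    the premeasure above [c]. Once all are fixed the witnesses form a compact set, and compactness
    carries the lower bound to the limit. *)
Lemma analytic_capacitable s n A c :
  analytic A -> c < net s n A ->
  exists K, prefix_closed K /\ (forall x, K x -> A x) /\ c <= net s n K.
Proof.
  intros (F & HF & HA) Hc.
  set (B := fun (k : nat) (g : Baire) x =>
              exists y, F x y /\ forall i, (i < k)%nat -> (y i <= g i)%nat).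
  destruct (dependent_extension (fun k g => c < net s n (B k g))) as [g Hg].
  - intros k g g' Hgg H. eapply Rlt_le_trans; [exact H|].
    apply net_mono; auto. intros x (y & Hy & Hyg). exists y. split; auto.
    intros i Hi. rewrite <- Hgg; auto.
  - exists (fun _ => 0%nat). eapply Rlt_le_trans; [exact Hc|].
    apply net_mono; auto. intros x Hx. apply HA in Hx. destruct Hx as [y Hy].
    exists y. split; auto. intros i Hi. lia.
  (* [B k g] is the increasing union, over the bound [m] placed on coordinate [k], of the sets
     [B (S k) (g' m)]; by continuity one of them keeps premeasure above [c]. *)
  - intros k g H. set (g' := fun m i => if Nat.eq_dec i k then m else g i).
    apply NNPP. intros Hn. apply (Rlt_not_le _ _ H).
    apply net_increasing with (fun m => B (S k) (g' m)).
    + intros m x (y & Hy & Hyg). exists y. split; auto. intros i Hi.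
      specialize (Hyg i Hi). unfold g' in *. destruct Nat.eq_dec; lia.
    + intros x (y & Hy & Hyg). exists (y k), y. split; auto. intros i Hi.
      unfold g'. destruct Nat.eq_dec as [->|]; auto. apply Hyg. lia.
    + intros m. apply Rnot_lt_le. intros Hlt. apply Hn. exists (g' m). split; auto.
      intros i Hi. unfold g'. destruct Nat.eq_dec; auto; lia.
  - exists (fun x => exists y, F x y /\ forall i, (y i <= g i)%nat). repeat split.
    (* The projection is closed: witnesses of points converging to [x] are bounded by [g] and
       cluster at a witness for [x]. *)
    + intros x Hx.
      destruct (choice (fun n (p : Cantor * Baire) => agree n x (fst p) /\ F (fst p) (snd p) /\
                          forall i, (snd p i <= g i)%nat)) as [p Hp].
      { intros m. destruct (Hx m) as (x' & Ha & y' & Hy). now exists (x', y'). }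
      destruct (bounded_cluster F g (fun k => fst (p k)) (fun k => snd (p k)) HF)
        as (x' & y' & HF' & Hy' & Hcl).
      * intros k. apply Hp.
      * intros k i _. apply Hp.
      * exists y'. split; auto. apply HF. intros m. exists x', y'.
        repeat split; auto. destruct (Hcl m m) as [k [Hk Ha]].
        apply agree_trans with (fst (p k)); [|now apply agree_sym].
        apply agree_le with k; auto. apply Hp.
    + intros x (y & Hy & _). apply HA. now exists y.
    + apply Rnot_lt_le. intros Hlt. apply net_cover_gt in Hlt.
      destruct Hlt as (S & HS & Hcov & Hb).
      (* by compactness, a cover of the bounded part already covers some B k g *)
      assert (Hk : exists k, covers S (B k g)).
      { apply NNPP. intros Hn.
        destruct (choice (fun k (p : Cantor * Baire) => F (fst p) (snd p) /\
                    (forall i, (i < k)%nat -> (snd p i <= g i)%nat) /\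
                    forall m, ~ S (pre (fst p) m))) as [p Hp].
        { intros k. apply NNPP. intros Hk. apply Hn. exists k. intros x (y & Hy & Hyg).
          apply NNPP. intros Hm. apply Hk. exists (x, y). repeat split; auto.
          intros m Hm'. apply Hm. now exists m. }
        destruct (bounded_cluster F g (fun k => fst (p k)) (fun k => snd (p k)) HF)
          as (x & y & HF' & Hy & Hcl); [apply Hp|apply Hp|].
        destruct (Hcov x) as [m Hm]; [now exists y|].
        destruct (Hcl m 0%nat) as [k [_ Ha]]. apply map_seq_agree in Ha.
        apply (Hp k) with m. unfold pre. now rewrite <- Ha. }
      destruct Hk as [k Hk]. apply (Rlt_not_le _ _ (Hg k)).
      apply net_le_cover. now exists S.
Qed.

(** * Comparison of Hausdorff measure with the net premeasures *)

Lemma inv_pow2_pos n : 0 < / 2 ^ n.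
Proof. apply Rinv_0_lt_compat, pow_lt. lra. Qed.

Lemma inv_pow2_le m n : (m <= n)%nat -> / 2 ^ n <= / 2 ^ m.
Proof.
  intros H. apply Rinv_le_contravar; [apply pow_lt; lra|]. apply Rle_pow; auto. lra.
Qed.

Lemma inv_pow2_lt m n : (m < n)%nat -> / 2 ^ n < / 2 ^ m.
Proof.
  intros H. apply Rinv_lt_contravar; [apply Rmult_lt_0_compat; apply pow_lt; lra|].
  apply Rlt_pow; auto. lra.
Qed.

Lemma inv_pow2_small d : 0 < d -> exists n, / 2 ^ n <= d.
Proof.
  intros Hd. destruct (pow_lt_1_zero (/ 2)) with (y := d) as [N HN]; auto.
  - rewrite Rabs_right; lra.
  - exists N. specialize (HN N (le_n _)). rewrite pow_inv in HN.
    rewrite Rabs_right in HN; [lra|]. apply Rle_ge, Rlt_le, inv_pow2_pos.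
Qed.

Lemma cdist_agree n x y : agree n x y -> cdist x y <= / 2 ^ n.
Proof.
  intros H. unfold cdist. destruct excluded_middle_informative as [He|He].
  - destruct constructive_indefinite_description as [k [Hk Hk']]. simpl.
    apply inv_pow2_le. destruct (le_lt_dec n k); auto. destruct Hk. now apply H.
  - apply Rlt_le, inv_pow2_pos.
Qed.

Lemma cdist_lt_agree n x y : cdist x y < / 2 ^ n -> agree (S n) x y.
Proof.
  unfold cdist. destruct excluded_middle_informative as [He|He].
  - destruct constructive_indefinite_description as [k [Hk Hk']]. simpl. intros H.
    destruct (le_lt_dec k n) as [Hkn|Hkn].
    + apply inv_pow2_le in Hkn. lra.
    + intros i Hi. apply Hk'. lia.
  - intros _ i Hi. apply NNPP. intros Hne. apply He.
    destruct (dec_inh_nat_subset_has_unique_least_element (fun i => x i <> y i))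
      as [j [[Hj Hmin] _]].
    + intros j. apply classic.
    + eauto.
    + exists j. split; auto. intros m Hm. apply NNPP. intros Hne'.
      specialize (Hmin m Hne'). lia.
Qed.

(** [Fin] admits all negative reals, so the empty set has no least upper bound; a finite member
    rules it out and lets completeness apply. *)
Lemma ER_sup_lub S : (exists r, S (Fin r)) -> is_ER_lub S (ER_sup S).
Proof.
  intros [r0 Hr0]. unfold ER_sup. destruct excluded_middle_informative as [H|H].
  - exact (proj2_sig (constructive_indefinite_description _ H)).
  - exfalso. apply H.
    destruct (classic (exists M, forall w, S w -> ERle w (Fin M))) as [[M HM]|HM].
    + destruct (completeness (fun r => S (Fin r))) as [l [Hub Hlub]].
      * exists M. intros r Hr. exact (HM _ Hr).
      * now exists r0.
      * exists (Fin l). split.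
        -- intros [r|] Hr; [now apply Hub|exact (HM _ Hr)].
        -- intros [z|] Hz; simpl; auto. apply Hlub. intros r Hr. exact (Hz _ Hr).
    + exists PInf. split.
      * intros [r|] _; exact I.
      * intros [z|] Hz; simpl; auto. apply HM. now exists z.
Qed.

Lemma ER_inf_glb S : (forall v, S v -> ERle (Fin 0) v) -> is_ER_glb S (ER_inf S).
Proof.
  intros H0. unfold ER_inf. destruct excluded_middle_informative as [H|H].
  - exact (proj2_sig (constructive_indefinite_description _ H)).
  - exfalso. apply H.
    destruct (classic (exists r, S (Fin r))) as [[r0 Hr0]|Hn].
    + destruct (completeness (fun r => S (Fin (- r)))) as [l [Hub Hlub]].
      * exists 0. intros r Hr. specialize (H0 _ Hr). simpl in H0. lra.
      * exists (- r0). now rewrite Ropp_involutive.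
      * exists (Fin (- l)). split.
        -- intros [r|] Hr; simpl; auto. enough (- r <= l) by lra.
           apply Hub. now rewrite Ropp_involutive.
        -- intros [z|] Hz; simpl.
           ++ enough (l <= - z) by lra. apply Hlub. intros r Hr.
              specialize (Hz _ Hr). simpl in Hz. lra.
           ++ exact (Hz _ Hr0).
    + exists PInf. split.
      * intros [r|] Hr; [destruct Hn; now exists r|exact I].
      * intros [z|] _; exact I.
Qed.

Lemma ERle_trans a b c : ERle a b -> ERle b c -> ERle a c.
Proof. destruct a, b, c; simpl; try tauto. lra. Qed.

(** For empty [U] the supremum does not exist and [diam] falls to its default 0; here [0 <= r] is
    used. *)
Lemma diam_le U r :
  0 <= r -> (forall x y, U x -> U y -> cdist x y <= r) -> diam U <= r.
Proof.
  intros Hr H. unfold diam, ER_sup.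
  destruct excluded_middle_informative as [He|He]; auto.
  destruct constructive_indefinite_description as [v [Hub Hlub]]. simpl. clear Hub.
  assert (Hv := Hlub (Fin r)). destruct v as [v|]; auto.
  apply Hv. intros w (x & y & Hx & Hy & ->). simpl. auto.
Qed.

Lemma cdist_le_diam (U : Cantor -> Prop) x y : U x -> U y -> cdist x y <= diam U.
Proof.
  intros Hx Hy. unfold diam.
  destruct (ER_sup_lub (fun v => exists x y, U x /\ U y /\ v = Fin (cdist x y)))
    as [Hub Hlub]; [exists (cdist x y), x, y; auto|].
  set (v := ER_sup _) in *.
  (* Distances are at most 1, so the supremum is finite and [diam] does not take its default. *)
  assert (H1 : ERle v (Fin 1)).
  { apply Hlub. intros w (x' & y' & _ & _ & ->). simpl.
    replace 1 with (/ 2 ^ 0) by (simpl; field). apply cdist_agree. intros i Hi. lia. }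
  specialize (Hub (Fin (cdist x y)) (ex_intro _ x (ex_intro _ y (conj Hx (conj Hy eq_refl))))).
  destruct v; [exact Hub|easy].
Qed.

Lemma rpow_nonneg r s : 0 <= rpow r s.
Proof. unfold rpow. destruct Rle_dec; [lra|]. apply Rlt_le, exp_pos. Qed.

Lemma rpow_le_weight s r u : 0 < s -> r <= / 2 ^ length u -> rpow r s <= weight s u.
Proof.
  intros Hs H. unfold rpow. destruct Rle_dec; [apply Rlt_le, weight_pos|].
  apply Rle_Rpower_l; lra.
Qed.

Lemma weight_small s n e : 0 < s -> 0 < e ->
  exists m, (n <= m)%nat /\ forall u, length u = m -> weight s u <= e.
Proof.
  intros Hs He.
  assert (Hl2 : 0 < ln 2) by (rewrite <- ln_1; apply ln_increasing; lra).
  assert (Hp : 0 < s * ln 2) by nra.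
  (* The bound on [k] says that 2^(-s k) is below [e]. *)
  destruct (INR_unbounded (- ln e / (s * ln 2))) as [k Hk].
  exists (n + k)%nat. split; [lia|]. intros u Hu.
  unfold weight, Rpower. rewrite Hu, ln_Rinv, ln_pow by (try apply pow_lt; lra).
  rewrite <- (exp_ln e He).
  assert (Hle : s * - (INR (n + k) * ln 2) <= ln e).
  { rewrite plus_INR. pose proof (pos_INR n).
    apply (Rmult_lt_compat_r (s * ln 2)) in Hk; auto.
    unfold Rdiv in Hk. rewrite Rmult_assoc, Rinv_l in Hk by lra. nra. }
  destruct Hle as [Hlt|Heq]; [apply Rlt_le, exp_increasing, Hlt|rewrite Heq; lra].
Qed.

(** If the diameter is positive, the least [m] with 2^-m below or equal to it gives a common prefix
    of length [m]. A set of diameter 0 costs nothing while every cylinder has positive weight, hence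
    the allowance [e]. *)
Lemma enclosing_cylinder s n U e :
  0 < s -> 0 < e -> diam U <= / 2 ^ n ->
  exists v, (n <= length v)%nat /\ (forall x, U x -> exists m, pre x m = v) /\
            weight s v <= rpow (diam U) s + e.
Proof.
  intros Hs He Hd.
  assert (H : exists x m, (n <= m)%nat /\ (forall y, U y -> agree m y x) /\
                weight s (pre x m) <= rpow (diam U) s + e).
  { destruct (weight_small s n e Hs He) as (M & HM & Hw).
    pose proof (rpow_nonneg (diam U) s).
    destruct (classic (exists x, U x)) as [[x Hx]|Hn].
    - exists x. destruct (Rle_lt_dec (diam U) 0) as [Hd0|Hd0].
      + exists M. repeat split; auto.
        * intros y Hy. pose proof (cdist_le_diam U y x Hy Hx).
          apply agree_le with (S M); [lia|]. apply cdist_lt_agree.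
          pose proof (inv_pow2_pos M). lra.
        * specialize (Hw (pre x M) (pre_length x M)). lra.
      + destruct (dec_inh_nat_subset_has_unique_least_element (fun m => / 2 ^ m <= diam U))
          as [m [[Hm Hmin] _]].
        * intros m. apply classic.
        * now apply inv_pow2_small.
        * exists m. repeat split.
          -- destruct (le_lt_dec n m) as [|Hlt]; auto.
             apply inv_pow2_lt in Hlt. lra.
          -- intros y Hy. destruct m as [|p]; [intros i Hi; lia|].
             apply cdist_lt_agree. pose proof (cdist_le_diam U y x Hy Hx).
             apply Rle_lt_trans with (diam U); auto. apply Rnot_le_lt. intros Hle.
             specialize (Hmin p Hle). lia.
          -- enough (weight s (pre x m) <= rpow (diam U) s) by lra.
             unfold rpow. destruct Rle_dec; [lra|].
             unfold weight. rewrite pre_length. apply Rle_Rpower_l; [lra|].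
             split; auto. apply inv_pow2_pos.
    - exists (fun _ => false), M. repeat split; auto.
      + intros y Hy. destruct Hn. now exists y.
      + specialize (Hw (pre (fun _ => false) M) (pre_length _ M)). lra. }
  destruct H as (x & m & Hnm & Hm & Hw). exists (pre x m).
  rewrite pre_length. repeat split; auto.
  intros y Hy. exists m. apply map_seq_agree. auto.
Qed.

(** Base two with digits 1 and 2, which makes the code injective on strings of all lengths. *)
Fixpoint enc (u : list bool) : nat :=
  match u with
  | [] => 0%nat
  | b :: u' => (2 * enc u' + (if b then 1 else 2))%nat
  end.

Lemma enc_inj u v : enc u = enc v -> u = v.
Proof.
  revert v. induction u as [|a u IH]; intros [|b v] H; simpl in H; auto.
  - destruct b; lia.
  - destruct a; lia.
  - destruct a, b; try lia; f_equal; apply IH; lia.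
Qed.

Lemma ER_series_lub a :
  is_ER_lub (fun v => exists n, v = Fin (sum_f_R0 a n)) (ER_series a).
Proof. apply ER_sup_lub. exists (sum_f_R0 a 0). now exists 0%nat. Qed.

Lemma HausS_delta_glb s delta A :
  is_ER_glb (fun v => exists U : nat -> (Cantor -> Prop),
            (forall x, A x -> exists i, U i x) /\
            (forall i, diam (U i) <= delta) /\
            v = ER_series (fun i => rpow (diam (U i)) s)) (HausS_delta s delta A).
Proof.
  apply ER_inf_glb. intros v (U & _ & _ & ->).
  apply ERle_trans with (Fin (sum_f_R0 (fun i => rpow (diam (U i)) s) 0)).
  - apply rpow_nonneg.
  - apply ER_series_lub. now exists 0%nat.
Qed.

(** The cylinders of [F] are listed by their codes, with the empty set at numbers that code no
    member. A partial sum of the series is then dominated by a sum over distinct strings. *)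
Lemma HausS_delta_le_cover s delta n A c :
  0 < s -> / 2 ^ n <= delta -> net_cover s n A c -> ERle (HausS_delta s delta A) (Fin c).
Proof.
  intros Hs Hd (F & HF & Hcov & Hb).
  set (U := fun (i : nat) (x : Cantor) => exists m, enc (pre x m) = i /\ F (pre x m)).
  assert (HU : forall i, diam (U i) <= delta /\
             exists l, NoDup l /\ (forall u, In u l -> enc u = i) /\
                       rpow (diam (U i)) s <= lsum (wind s F) l).
  { intros i. pose proof (inv_pow2_pos n).
    destruct (classic (exists x, U i x)) as [(x & m & Hm & Hu)|Hn].
    - set (u := pre x m) in *.
      assert (Hdu : diam (U i) <= / 2 ^ length u).
      { apply diam_le; [apply Rlt_le, inv_pow2_pos|].
        intros y z (my & Hy & _) (mz & Hz & _). apply cdist_agree, map_seq_agree.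
        rewrite <- Hm in Hy, Hz. apply enc_inj in Hy, Hz.
        rewrite <- (f_equal (@length bool) Hy) at 1.
        rewrite <- (f_equal (@length bool) Hz) at 1.
        rewrite !pre_length. unfold pre in Hy, Hz. congruence. }
      split.
      + specialize (HF u Hu). apply inv_pow2_le in HF. lra.
      + exists [u]. repeat split.
        * repeat constructor. intros [].
        * now intros v [<-|[]].
        * simpl. pose proof (rpow_le_weight s _ u Hs Hdu). unfold wind.
          destruct excluded_middle_informative; [lra|easy].
    - assert (Hd0 : diam (U i) <= 0).
      { apply diam_le; [lra|]. intros x y Hx. destruct Hn. now exists x. }
      split; [lra|]. exists []. repeat split.
      + constructor.
      + intros u [].
      + unfold rpow. destruct Rle_dec; simpl; lra. }
  apply ERle_trans with (ER_series (fun i => rpow (diam (U i)) s)).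
  - apply HausS_delta_glb. exists U. repeat split; [|apply HU].
    intros x Hx. destruct (Hcov x Hx) as [m Hm]. exists (enc (pre x m)), m. auto.
  - apply ER_series_lub. intros w [N ->]. simpl.
    assert (HN : exists l, NoDup l /\ (forall u, In u l -> (enc u <= N)%nat) /\
              sum_f_R0 (fun i => rpow (diam (U i)) s) N <= lsum (wind s F) l).
    { induction N as [|N (l & Hl & HlN & Hsum)].
      - destruct (HU 0%nat) as (_ & l & Hl & Hl0 & Hs0). exists l. repeat split; auto.
        intros u Hu. rewrite (Hl0 u Hu). lia.
      - destruct (HU (S N)) as (_ & l' & Hl' & HlS & HsS). exists (l ++ l').
        repeat split.
        + apply NoDup_app; auto. intros u Hu Hu'.
          specialize (HlN u Hu). specialize (HlS u Hu'). lia.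
        + intros u Hu. apply in_app_iff in Hu. destruct Hu as [Hu|Hu].
          * specialize (HlN u Hu). lia.
          * specialize (HlS u Hu). lia.
        + rewrite tech5, lsum_app. lra. }
    destruct HN as (l & Hl & _ & HlN). specialize (Hb l Hl). lra.
Qed.

Lemma HausS_delta_le_net s delta n A :
  0 < s -> / 2 ^ n <= delta -> ERle (HausS_delta s delta A) (Fin (net s n A)).
Proof.
  intros Hs Hd.
  assert (H : forall c, net s n A < c -> ERle (HausS_delta s delta A) (Fin c)).
  { intros c Hc. apply HausS_delta_le_cover with n; auto. now apply net_cover_gt. }
  destruct (HausS_delta s delta A) as [r|]; simpl in *.
  - apply le_epsilon. intros e He. apply H. lra.
  - apply (H (net s n A + 1)). lra.
Qed.

(** Each covering set is replaced by an enclosing cylinder of length at least [n], at extra cost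
    [e / 2^(i+1)]. *)
Lemma net_le_HausS_delta s n A :
  0 < s -> ERle (Fin (net s n A)) (HausS_delta s (/ 2 ^ n) A).
Proof.
  intros Hs. apply HausS_delta_glb. intros v (U & HA & HU & ->).
  pose proof (proj1 (ER_series_lub (fun i => rpow (diam (U i)) s))) as Hub.
  destruct (ER_series _) as [c|]; simpl; auto.
  apply le_epsilon. intros e He.
  destruct (choice (fun i v => (n <= length v)%nat /\
              (forall x, U i x -> exists m, pre x m = v) /\
              weight s v <= rpow (diam (U i)) s + e * / 2 ^ S i)) as [v Hv].
  { intros i. apply enclosing_cylinder; auto.
    pose proof (inv_pow2_pos (S i)). nra. }
  apply net_le_cover. exists (fun u => exists i, u = v i). repeat split.
  - intros u [i ->]. apply Hv.
  - intros x Hx. destruct (HA x Hx) as [i Hi].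
    destruct (proj1 (proj2 (Hv i)) x Hi) as [m Hm]. now exists m, i.
  - intros l Hl. set (F := fun u => exists i, u = v i).
    (* The strings [v i] may repeat, so a finite list of members is compared with an initial segment
       of the sequence. *)
    assert (HN : exists N, forall u, In u l -> F u -> In u (map v (seq 0 (S N)))).
    { clear Hl. induction l as [|a l [N IH]]; [exists 0%nat; easy|].
      assert (Hin : forall i K, (i <= K)%nat -> In (v i) (map v (seq 0 (S K)))).
      { intros i K HiK. apply in_map, in_seq. lia. }
      destruct (classic (F a)) as [[i ->]|Ha].
      - exists (Nat.max N i). intros u [<-|Hu] Hv'; [apply Hin; lia|].
        specialize (IH u Hu Hv'). apply in_map_iff in IH.
        destruct IH as (j & <- & Hj). apply in_seq in Hj. apply Hin. lia.
      - exists N. intros u [<-|Hu] Hv'; [easy|auto]. }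
    destruct HN as [N HN].
    apply Rle_trans with (lsum (wind s F) (map v (seq 0 (S N)))).
    { apply lsum_incl; auto using wind_nonneg. intros u Hu. unfold wind.
      destruct excluded_middle_informative; [auto|lra]. }
    assert (Hsum : lsum (wind s F) (map v (seq 0 (S N))) <=
               sum_f_R0 (fun i => rpow (diam (U i)) s) N +
               sum_f_R0 (fun i => e * / 2 ^ S i) N).
    { assert (Hw : forall i, wind s F (v i) <= rpow (diam (U i)) s + e * / 2 ^ S i).
      { intros i. unfold wind. destruct excluded_middle_informative as [|Hn]; [apply Hv|].
        destruct Hn. now exists i. }
      clear HN. induction N as [|N IH].
      - specialize (Hw 0%nat). simpl in *. lra.
      - rewrite seq_S, map_app, lsum_app, !tech5. specialize (Hw (S N)). simpl in *. lra. }
    pose proof (sum_half_powers e N ltac:(lra)).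
    specialize (Hub _ (ex_intro _ N eq_refl)). simpl in Hub. lra.
Qed.

(** The radii 2^-n are cofinal, so the measure is the supremum of the net premeasures. The rest of
    the argument meets the measure only in this form. *)
Lemma HausS_le s A c :
  0 < s -> (ERle (HausS s A) (Fin c) <-> forall n, net s n A <= c).
Proof.
  intros Hs.
  destruct (ER_sup_lub (fun v => exists delta, 0 < delta /\ v = HausS_delta s delta A))
    as [Hub Hlub].
  { pose proof (HausS_delta_le_net s (/ 2 ^ 0) 0 A Hs (Rle_refl _)) as H.
    destruct (HausS_delta s (/ 2 ^ 0) A) as [r|] eqn:E; [|easy].
    exists r, (/ 2 ^ 0). split; [apply inv_pow2_pos|easy]. }
  fold (HausS s A) in Hub, Hlub. split.
  - intros H n. change (ERle (Fin (net s n A)) (Fin c)).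
    eapply ERle_trans; [apply net_le_HausS_delta, Hs|].
    eapply ERle_trans; [|exact H]. apply Hub.
    exists (/ 2 ^ n). split; [apply inv_pow2_pos|easy].
  - intros H. apply Hlub. intros v (delta & Hd & ->).
    destruct (inv_pow2_small delta Hd) as [n Hn].
    eapply ERle_trans; [apply HausS_delta_le_net; eauto|]. apply H.
Qed.

(** * Measurability *)

(** [net] grows with the level, so bounds at a common level give bounds at two independent levels,
    and the two suprema can be taken one after the other. *)
Lemma HausS_measurable_of_bound s A :
  0 < s ->
  (forall T v, (forall n, net s n T <= v) ->
     forall n, net s n (fun x => T x /\ A x) + net s n (fun x => T x /\ ~ A x) <= v) ->
  HausS_measurable s A.
Proof.
  intros Hs H T.
  pose proof (fun c => HausS_le s T c Hs) as HT.
  pose proof (fun c => HausS_le s (fun x => T x /\ A x) c Hs) as HX.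
  pose proof (fun c => HausS_le s (fun x => T x /\ ~ A x) c Hs) as HY.
  assert (Hsum : forall c, ERle (HausS s T) (Fin c) <->
            ERle (ERadd (HausS s (fun x => T x /\ A x)) (HausS s (fun x => T x /\ ~ A x)))
                 (Fin c)).
  { intros c. rewrite HT. split.
    - intros Hc.
      assert (Hab : forall n m, net s n (fun x => T x /\ A x) +
                      net s m (fun x => T x /\ ~ A x) <= c).
      { intros n m. specialize (H T c Hc (Nat.max n m)).
        pose proof (net_mono s n (Nat.max n m) (fun x => T x /\ A x) _
                      (Nat.le_max_l _ _) (fun _ Hx => Hx)).
        pose proof (net_mono s m (Nat.max n m) (fun x => T x /\ ~ A x) _
                      (Nat.le_max_r _ _) (fun _ Hx => Hx)). lra. }
      assert (HXc := proj2 (HX c)). assert (HYc := proj2 (HY c)).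
      destruct (HausS s (fun x => T x /\ A x)) as [a|].
      2:{ destruct HXc. intros n. specialize (Hab n n).
          pose proof (net_nonneg s n (fun x => T x /\ ~ A x)). lra. }
      destruct (HausS s (fun x => T x /\ ~ A x)) as [b|].
      2:{ destruct HYc. intros n. specialize (Hab n n).
          pose proof (net_nonneg s n (fun x => T x /\ A x)). lra. }
      simpl in *. enough (a <= c - b) by lra.
      apply HX. intros n. enough (b <= c - net s n (fun x => T x /\ A x)) by lra.
      apply HY. intros m. specialize (Hab n m). lra.
    - intros Hc n.
      destruct (HausS s (fun x => T x /\ A x)) as [a|]; [|easy].
      destruct (HausS s (fun x => T x /\ ~ A x)) as [b|]; [|easy].
      simpl in *. pose proof (proj1 (HX a) (Rle_refl _) n).
      pose proof (proj1 (HY b) (Rle_refl _) n).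
      pose proof (net_subadd s n (fun x => T x /\ A x) (fun x => T x /\ ~ A x) T
                    ltac:(intros x Hx; destruct (classic (A x)); auto)). lra. }
  (* By [Hsum] both sides have the same finite upper bounds, and these determine an element of
     [ER]. *)
  destruct (HausS s T) as [t|], (ERadd _ _) as [r|]; auto.
  - f_equal. apply Rle_antisym; apply Hsum; simpl; lra.
  - destruct (proj1 (Hsum t)). simpl; lra.
  - destruct (proj2 (Hsum r)). simpl; lra.
Qed.

(** The part of [T] outside [K] is the increasing union of the sets [D j] of points whose cylinder
    of length [j] misses [K]. Each [D j] is separated from [K], so a fine cover of [T] splits into
    two disjoint families. *)
Lemma closed_additive s K T v :
  prefix_closed K -> (forall n, net s n T <= v) ->
  forall n, net s n (fun x => T x /\ K x) + net s n (fun x => T x /\ ~ K x) <= v.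
Proof.
  intros HK HT n.
  set (D := fun j x => T x /\ forall x', agree j x x' -> ~ K x').
  enough (net s n (fun x => T x /\ ~ K x) <= v - net s n (fun x => T x /\ K x)) by lra.
  apply net_increasing with D.
  - intros j x [Hx H]. split; auto. intros x' Ha. apply H.
    apply agree_le with (S j); auto.
  - intros x [Hx Hn]. apply NNPP. intros Hno. apply Hn, HK. intros j.
    apply NNPP. intros Hj. apply Hno. exists j. split; auto.
    intros x' Ha HKx. apply Hj. now exists x'.
  - (* cylinders of length at least j cannot meet both D j and K *)
    intros j. set (N := Nat.max n j).
    pose proof (net_mono s n N (D j) (D j) ltac:(lia) (fun _ Hx => Hx)).
    pose proof (net_mono s n N (fun x => T x /\ K x) (fun x => T x /\ K x) ltac:(lia)
                  (fun _ Hx => Hx)).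
    specialize (HT N). enough (net s N (fun x => T x /\ K x) + net s N (D j) <= v) by lra.
    apply le_epsilon. intros e He.
    destruct (net_cover_gt s N T (v + e) ltac:(lra)) as (F & HF & Hcov & Hb).
    set (F1 := fun u => F u /\ exists x m, pre x m = u /\ K x).
    set (F2 := fun u => F u /\ ~ exists x m, pre x m = u /\ K x).
    assert (H1 : forall l, NoDup l -> net s N (D j) <= v + e - lsum (wind s F1) l).
    { intros l Hl. apply net_le_cover. exists F2. repeat split.
      - intros u [Hu _]. auto.
      - intros x [Hx Hxj]. destruct (Hcov x Hx) as [m Hm]. exists m. split; auto.
        intros (x' & m' & Hx' & HKx). apply (Hxj x'); auto.
        assert (m' = m) as -> by (apply (f_equal (@length bool)) in Hx';
                                  now rewrite !pre_length in Hx').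
        apply agree_le with m.
        + specialize (HF _ Hm). rewrite pre_length in HF. lia.
        + apply agree_sym, map_seq_agree, Hx'.
      - assert (Hb' := bnd_split (wind s F1) (wind s F2) (wind s F) (fun _ => 0) (v + e) 0 l
                    (wind_nonneg s _) (wind_nonneg s _)).
        replace (v + e - lsum (wind s F1) l) with (v + e + 0 - lsum (wind s F1) l) by lra.
        apply Hb'; auto.
        + intros u. unfold wind, F1, F2. pose proof (weight_pos s u).
          repeat destruct excluded_middle_informative; lra || tauto.
        + intros l' _. clear. induction l'; simpl; lra. }
    enough (net s N (fun x => T x /\ K x) <= v + e - net s N (D j)) by lra.
    apply net_le_cover. exists F1. repeat split.
    + intros u [Hu _]. auto.
    + intros x [Hx HKx]. destruct (Hcov x Hx) as [m Hm]. exists m. split; auto.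
      now exists x, m.
    + intros l Hl. specialize (H1 l Hl). lra.
Qed.

(** A closed [K] inside [A] captures all but [e / 2] of the measure [M] of [A]. Splitting [T] along
    [K] is exact, and replacing [K] by [A] costs at most [e / 2]. *)
Lemma analytic_finite_measurable s A :
  0 < s -> analytic A -> (exists c, forall n, net s n A <= c) -> HausS_measurable s A.
Proof.
  intros Hs HA [c Hc]. apply HausS_measurable_of_bound; auto.
  intros T v HT n. apply le_epsilon. intros e He.
  destruct (completeness (fun r => exists n, r = net s n A)) as [M [Hub Hlub]].
  { exists c. intros r [m ->]. auto. }
  { now exists (net s 0 A), 0%nat. }
  assert (HMn : exists m, M - e / 2 < net s m A).
  { apply NNPP. intros Hn. assert (M <= M - e / 2); [|lra].
    apply Hlub. intros r [m ->]. apply Rnot_lt_le. intros Hlt. apply Hn. now exists m. }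
  destruct HMn as [m Hm].
  destruct (analytic_capacitable s m A (M - e / 2) HA Hm) as (K & HK & HKA & HKm).
  (* At level [p] the set [K] still has premeasure above [M - e / 2], and estimates there pass down
     to level [n]. *)
  set (p := Nat.max n m).
  pose proof (closed_additive s K T v HK HT n).
  pose proof (closed_additive s K A M HK ltac:(intros q; apply Hub; now exists q) p).
  assert (net s m K <= net s p (fun x => A x /\ K x)).
  { apply net_mono; [lia|]. auto. }
  assert (net s n (fun x => A x /\ ~ K x) <= net s p (fun x => A x /\ ~ K x)).
  { apply net_mono; [lia|]. auto. }
  assert (net s n (fun x => T x /\ ~ A x) <= net s n (fun x => T x /\ ~ K x)).
  { apply net_mono; auto. intros x [Hx Hn]. auto. }
  pose proof (net_subadd s n (fun x => T x /\ K x) (fun x => A x /\ ~ K x)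
                (fun x => T x /\ A x)
                ltac:(intros x [Hx Hx']; destruct (classic (K x)); auto)).
  lra.
Qed.

Lemma analytic_inter A Q :
  analytic A -> prefix_closed Q -> analytic (fun x => A x /\ Q x).
Proof.
  intros (F & HF & HA) HQ. exists (fun x y => F x y /\ Q x). split.
  - intros x y H. split.
    + apply HF. intros n. destruct (H n) as (x' & y' & ? & ? & ? & ?). eauto.
    + apply HQ. intros n. destruct (H n) as (x' & y' & ? & ? & ? & ?). eauto.
  - intros x. rewrite HA. firstorder.
Qed.

(** The condition at [n] reads only the first [n] values of [x] and [y], so it passes to limits. *)
Lemma Sigma11_analytic E : Sigma11 E -> analytic E.
Proof.
  intros (c & _ & HE).
  exists (fun x y => forall n, reval c [bprefix x n; nprefix y n] 0%nat). split; auto.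
  intros x y H n. destruct (H n) as (x' & y' & Hx & Hy & Hr). specialize (Hr n).
  unfold bprefix, nprefix in *.
  apply map_seq_agree in Hy. rewrite Hy.
  replace (map (fun k => if x k then 1%nat else 0%nat) (seq 0 n))
    with (map (fun k => if x' k then 1%nat else 0%nat) (seq 0 n)); auto.
  apply map_seq_agree. intros i Hi. now rewrite (Hx i Hi).
Qed.

(** * Closed subsets of infinite measure *)

Lemma prefix_closed_cantor C : prefix_closed C -> cantor_closed C.
Proof.
  intros HC x Hx.
  assert (Hn : exists n, forall y, agree n x y -> ~ C y).
  { apply NNPP. intros Hn. apply Hx, HC. intros n. apply NNPP. intros Hn'.
    apply Hn. exists n. intros y Ha Hy. apply Hn'. now exists y. }
  destruct Hn as [n Hn]. exists (/ 2 ^ n). split; [apply inv_pow2_pos|].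
  intros y Hy. apply Hn. apply agree_le with (S n); [lia|]. now apply cdist_lt_agree.
Qed.

Definition cylinder (x : Cantor) (n : nat) (y : Cantor) : Prop := agree n x y.

Lemma cylinder_closed x n : prefix_closed (cylinder x n).
Proof.
  intros y H. destruct (H n) as (y' & Ha & Hy).
  eapply agree_trans; [exact Hy|now apply agree_sym].
Qed.

(** If [y] differs from [x] at [j], close approximations to [y] differ from [x] there too and must
    come from [K 0], ..., [K j]; one of these finitely many closed sets supplies infinitely many of
    them. *)
Lemma closed_shrinking_union x (K : nat -> Cantor -> Prop) :
  (forall n, prefix_closed (K n)) ->
  (forall n y, K n y -> agree n x y) ->
  prefix_closed (fun y => (forall i, y i = x i) \/ exists n, K n y).
Proof.
  intros HK Hx y Hy.
  destruct (classic (forall i, y i = x i)) as [|Hne]; [now left|right].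
  apply not_all_ex_not in Hne. destruct Hne as [j Hj].
  destruct (infinite_pigeonhole (seq 0 (S j))
              (fun i m => exists y', agree m y y' /\ K i y')) as (i & _ & Hi).
  - intros N. destruct (Hy (N + S j)%nat) as (y' & Ha & Hy').
    exists (N + S j)%nat. destruct Hy' as [Heq|[i Hi]].
    + destruct Hj. rewrite <- Heq. apply Ha. lia.
    + exists i. repeat split; [lia| |now exists y'].
      apply in_seq. destruct (le_lt_dec i j); [lia|].
      destruct Hj. rewrite (Hx i y' Hi j) by auto. apply Ha. lia.
  - exists i. apply HK. intros n. destruct (Hi n) as (m & Hnm & y' & Ha & Hy').
    exists y'. split; auto. now apply agree_le with m.
Qed.

Lemma sigma_finite_of_locally_finite s E :
  0 < s -> analytic E ->
  (forall x, E x -> exists n c, forall m, net s m (fun y => E y /\ cylinder x n y) <= c) ->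
  HausS_sigma_finite s E.
Proof.
  intros Hs HE Hloc.
  (* [Q i] is the cylinder with code [i] if [E] has finite measure in it, and empty otherwise. *)
  set (Q := fun i y => exists n, enc (pre y n) = i /\
              exists c, forall m, net s m (fun z => E z /\ cylinder y n z) <= c).
  assert (HQ : forall i, prefix_closed (Q i)).
  (* One point of [Q i] fixes the length [n] of the coded string; a second one agreeing with [y] to
     that length places [y] in the same cylinder. *)
  { intros i y Hy. destruct (Hy 0%nat) as (y0 & _ & n & Hn & c & Hc).
    destruct (Hy n) as (y1 & Ha & n1 & Hn1 & _).
    rewrite <- Hn in Hn1. apply enc_inj in Hn1.
    assert (n1 = n) as -> by (apply (f_equal (@length bool)) in Hn1;
                              now rewrite !pre_length in Hn1).
    assert (Hay : agree n y y0).
    { eapply agree_trans; [exact Ha|]. now apply map_seq_agree. }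
    exists n. split.
    - rewrite <- Hn. f_equal. now apply map_seq_agree.
    - exists c. intros m. eapply Rle_trans; [|apply (Hc m)].
      apply net_mono; auto. intros z [Hz Hz']. split; auto.
      apply agree_trans with y; auto. now apply agree_sym. }
  assert (Hfin : forall i, exists c, forall m, net s m (fun y => E y /\ Q i y) <= c).
  { intros i. destruct (classic (exists y, Q i y)) as [(y & n & Hn & c & Hc)|Hno].
    - exists c. intros m. eapply Rle_trans; [|apply (Hc m)].
      apply net_mono; auto. intros z [Hz (n' & Hn' & _)]. split; auto.
      rewrite <- Hn in Hn'. apply enc_inj in Hn'.
      assert (n' = n) as -> by (apply (f_equal (@length bool)) in Hn';
                                now rewrite !pre_length in Hn').
      apply map_seq_agree. now symmetry.
    - exists 0. intros m. apply net_le_cover. exists (fun _ => False).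
      split; [easy|split].
      + intros y [_ Hy]. destruct Hno. now exists y.
      + intros l _. induction l as [|a l IH]; simpl; [lra|].
        unfold wind at 1. destruct excluded_middle_informative; [easy|]. lra. }
  exists (fun i y => E y /\ Q i y). repeat split.
  - intros i. apply analytic_finite_measurable; auto. apply analytic_inter; auto.
  - intros i Hi. destruct (Hfin i) as [c Hc]. apply HausS_le in Hc; auto.
    now rewrite Hi in Hc.
  - intros Hx. destruct (Hloc x Hx) as (n & c & Hc).
    exists (enc (pre x n)). split; auto. exists n. eauto.
  - now intros [i [Hx _]].
Qed.

Theorem mainTheorem2 (s : R) (E : Cantor -> Prop) :
  0 < s ->
  Sigma11 E ->
  ~ HausS_sigma_finite s E ->
  exists C : Cantor -> Prop,
    cantor_closed C /\ (forall x, C x -> E x) /\ HausS s C = PInf.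
Proof.
  intros Hs HS HE. apply Sigma11_analytic in HS.
  assert (Hx : exists x, E x /\ forall n c, exists m,
             c < net s m (fun y => E y /\ cylinder x n y)).
  { apply NNPP. intros Hno. apply HE. apply sigma_finite_of_locally_finite; auto.
    intros x Hx. apply NNPP. intros Hn. apply Hno. exists x. split; auto.
    intros n c. apply NNPP. intros Hm. apply Hn. exists n, c. intros m.
    apply Rnot_lt_le. intros Hlt. apply Hm. now exists m. }
  destruct Hx as (x & Hx & Hbig).
  destruct (choice (fun n K => prefix_closed K /\
              (forall y, K y -> E y /\ agree n x y) /\
              exists m, INR n <= net s m K)) as [K HK].
  { intros n. destruct (Hbig n (INR n)) as [m Hm].
    destruct (analytic_capacitable s m _ (INR n)
                (analytic_inter E (cylinder x n) HS (cylinder_closed x n)) Hm)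
      as (K & H1 & H2 & H3). exists K. eauto. }
  exists (fun y => (forall i, y i = x i) \/ exists n, K n y). repeat split.
  - apply prefix_closed_cantor, closed_shrinking_union.
    + intros n. apply HK.
    + intros n y Hy. now apply (HK n).
  - intros y [Heq|[n Hn]]; [|now apply (HK n)].
    (* Here [y] equals [x] pointwise, and closedness of [F] moves the witness for [x] to [y]. *)
    destruct HS as (F & HF & HEF). apply HEF. apply HEF in Hx. destruct Hx as [z Hz].
    exists z. apply HF. intros n. exists x, z. repeat split; auto. intros i _. apply Heq.
  - pose proof (fun c => HausS_le s (fun y => (forall i, y i = x i) \/ exists n, K n y)
                  c Hs) as H.
    destruct (HausS s _) as [c|]; auto. exfalso.
    (* A finite value [c] is exceeded by the premeasure of [K n] for any [n] above [c]. *)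
    destruct (INR_unbounded c) as [n Hn].
    destruct (proj2 (proj2 (HK n))) as [m Hm].
    pose proof (proj1 (H c) (Rle_refl _) m).
    pose proof (net_mono s m m (K n) (fun y => (forall i, y i = x i) \/ exists n, K n y)
                  (le_n _) (fun y Hy => or_intror (ex_intro _ n Hy))). lra.
Qed.
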